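(* If $(S_t)$ is $l_0$-sub-$\psi$ with variance process $(V_t)$, where $\psi$ is CGF-like and $\bar b=\infty$, then for any $\beta,x>0$ and $\alpha,m\ge0$ with at least one of $\alpha,m>0$, $$\mathbb P\left(\exists t\in\mathcal T:V_t\ge m\text{ and }\frac{S_t}{\alpha+\beta V_t}\ge x\right)\le\begin{cases}l_0\exp\{-\alpha xD(\beta x)\},&\beta x\le\mathfrak s\left(\frac{x(\alpha+\beta m)}m\right)\\[4pt] l_0\exp\left\{-m\psi^\star\left(\frac{x(\alpha+\beta m)}m\right)\right\},&\beta x\ge\mathfrak s\left(\frac{x(\alpha+\beta m)}m\right)\end{cases}$$ (the first case applying when $m=0$), and the right-hand side is in turn at most $$l_0\exp\left\{-m\psi^\star(\beta x)-\alpha x\,{\psi^\star}'(\beta x)\right\}.$$ In the case that $(S_t)$ is $l_0$-sub-Gaussian with variance process $(V_t)$ (i.e. $\psi(\lambda)=\lambda^2/2$ on $[0,\infty)$), for any $\beta,x>0$ and $\alpha,m\ge0$ with at least one of $\alpha,m>0$, $$\mathbb P\left(\exists t\in\mathcal T:V_t\ge m\text{ and }\frac{S_t}{\alpha+\beta V_t}\ge x\right)\le l_0\exp\left\{-x^2\left(2\alpha\beta+\frac{(\beta m-\alpha)^2\mathbf 1\{\alpha\le\beta m\}}{2m}\right)\right\},$$ taking $0/0=0$ on the right-hand side when $m=0$.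
   Context: Time index: either $\mathcal T=\mathbb N=\{1,2,\dots\}$ or $\mathcal T=(0,\infty)$. Processes are adapted to a filtration $(\mathcal F_t)_{t\in\mathcal T\cup\{0\}}$ with $\mathcal F_0$ trivial; in continuous time the filtration is right-continuous and complete and $(S_t),(V_t)$ are càdlàg. Real-valued adapted $(S_t),(V_t)$ with $S_0=V_0=0$, $V_t\ge0$: $(S_t)$ is $l_0$-sub-$\psi$ ($l_0\in[1,\infty)$, $\psi:[0,\lambda_{\max})\to\mathbb R$) with variance process $(V_t)$ if for each $\lambda\in[0,\lambda_{\max})$ there is a supermartingale $(L_t(\lambda))_{t\in\mathcal T\cup\{0\}}$ with $L_0(\lambda)\le l_0$ a.s. and $\exp\{\lambda S_t-\psi(\lambda)V_t\}\le L_t(\lambda)$ a.s. for all $t\in\mathcal T$. $\psi$ is CGF-like if it is strictly convex, twice continuously differentiable, $\psi(0)=\psi'(0_+)=0$ and $\sup_{\lambda\in[0,\lambda_{\max})}\psi(\lambda)=\infty$; $\bar b:=\sup_{\lambda\in[0,\lambda_{\max})}\psi'(\lambda)$. $\psi^\star(u):=\sup_{\lambda\in[0,\lambda_{\max})}[\lambda u-\psi(\lambda)]$; $D(u):=\sup\{\lambda\in(0,\lambda_{\max}):\psi(\lambda)/\lambda\le u\}$; $\mathfrak s(u):=\psi({\psi^\star}'(u))/{\psi^\star}'(u)$ for $u\in(0,\bar b)$. *)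

(* Defs.v *)
From HB Require Import structures.
From mathcomp Require Import all_boot all_order all_algebra.
From mathcomp Require Import all_classical all_reals all_analysis.
Import Order.TTheory GRing.Theory Num.Theory.
Import numFieldNormedType.Exports.

Set Implicit Arguments.
Unset Strict Implicit.
Unset Printing Implicit Defensive.

Local Open Scope classical_set_scope.
Local Open Scope ring_scope.

(* MathComp-Analysis.  A process is a function [X : R -> T -> R], with [X t] the
   variable at time [t].  Only its values at the times of [times R k] (that is,
   the naturals or the nonnegative reals) are ever constrained or used. *)

Inductive time_kind := DiscreteTime | ContinuousTime.

(* The index set together with the initial time 0. *)
Definition times (R : realType) (k : time_kind) : set R :=
  match k with
  | DiscreteTime => range (fun n : nat => n%:R)
  | ContinuousTime => [set t | 0 <= t]
  end.

Definition pos_times (R : realType) (k : time_kind) : set R :=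
  [set t | times k t /\ 0 < t].

Section Processes.
Context d (T : measurableType d) (R : realType).
Variable P : probability T R.
Implicit Types (k : time_kind) (F : R -> set_system T) (X : R -> T -> R).

Definition sub_measurable (G : set_system T) (Y : T -> R) : Prop :=
  forall B : set R, measurable B -> G (Y @^-1` B).

Record is_filtration k F : Prop := IsFiltration {
  filtration_sigma : forall t, times k t -> sigma_algebra setT (F t);
  filtration_measurable : forall t, times k t -> F t `<=` measurable;
  filtration_mono : forall s t, times k s -> times k t -> s <= t ->
    F s `<=` F t }.

(* Triviality is up to null sets, so that it is compatible with completeness. *)
Definition trivial_at0 F : Prop := forall A, F 0 A -> P A = 0%E \/ P A = 1%E.

Definition right_continuous_filtration F : Prop :=
  forall t, 0 <= t -> \bigcap_(s in [set s | t < s]) F s `<=` F t.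

(* [P.-negligible] sets are arbitrary subsets of null events, hence this also
   makes the underlying probability space complete. *)
Definition complete_filtration F : Prop :=
  forall N : set T, P.-negligible N -> F 0 N.

Definition cadlag (f : R -> R) : Prop :=
  (forall t, 0 <= t -> f s @[s --> t^'+] --> f t) /\
  (forall t, 0 < t -> cvg (f s @[s --> t^'-])).

Definition adapted k F X : Prop := forall t, times k t -> sub_measurable (F t) (X t).

Definition standing k F (S V : R -> T -> R) : Prop :=
  [/\ is_filtration k F, trivial_at0 F, adapted k F S /\ adapted k F V,
      (forall w, S 0 w = 0 /\ V 0 w = 0) /\
      (forall t w, times k t -> 0 <= V t w) &
      k = ContinuousTime ->
        [/\ right_continuous_filtration F, complete_filtration F &
            forall w, cadlag (S ^~ w) /\ cadlag (V ^~ w)]].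

(* [Y] is a version of the conditional expectation of [X] given [G]. *)
Definition is_cond_exp (G : set_system T) (X Y : T -> R) : Prop :=
  [/\ P.-integrable setT (EFin \o Y), sub_measurable G Y &
      forall A, G A ->
        (\int[P]_(w in A) (Y w)%:E = \int[P]_(w in A) (X w)%:E)%E].

Record supermartingale k F (L : R -> T -> R) : Prop := Supermartingale {
  supermartingale_adapted : adapted k F L;
  supermartingale_integrable : forall t, times k t ->
    P.-integrable setT (EFin \o L t);
  supermartingale_le : forall s t, times k s -> times k t -> s <= t ->
    exists2 Y, is_cond_exp (F s) (L t) Y & {ae P, forall w, Y w <= L s w} }.

(* Probability of an arbitrary set of outcomes: the infimum of the probabilities
   of its countable measurable covers.  It is [P A] whenever [A] is measurable
   ([outer_probE]); the values of [P] itself on nonmeasurable sets are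
   unspecified, and an existential over uncountably many times is not
   syntactically measurable. *)
Definition outer_prob (A : set T) : \bar R := mu_ext P A.

Lemma outer_probE (A : set T) : measurable A -> outer_prob A = P A.
Proof. exact: measurable_mu_extE. Qed.

(* The interval [0, lmax), where [lmax] may be infinite. *)
Definition psi_dom (lmax : \bar R) : set R :=
  [set l | 0 <= l /\ (l%:E < lmax)%E].

Definition psi_idom (lmax : \bar R) : set R :=
  [set l | 0 < l /\ (l%:E < lmax)%E].

Definition sub_psi k F (l0 : R) (lmax : \bar R) (psi : R -> R)
    (S V : R -> T -> R) : Prop :=
  forall l, psi_dom lmax l ->
    exists L, [/\ supermartingale k F L,
      {ae P, forall w, L 0 w <= l0} &
      forall t, pos_times k t ->
        {ae P, forall w, expR (l * S t w - psi l * V t w) <= L t w}].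

End Processes.

Section Psi.
Context (R : realType).
Implicit Types (lmax : \bar R) (psi : R -> R).

Definition strictly_convex_on (D : set R) (f : R -> R) : Prop :=
  forall x y t, D x -> D y -> x != y -> 0 < t -> t < 1 ->
    f (t * x + (1 - t) * y) < t * f x + (1 - t) * f y.

(* Two-sided derivatives are taken in the open interval (0, lmax), since [psi]
   carries no information to the left of 0.  At 0, [cgf_like_d0] is the right
   derivative; it makes [psi] right-continuous at 0. *)
Record cgf_like lmax psi : Prop := CgfLike {
  cgf_like_convex : strictly_convex_on (psi_dom lmax) psi;
  cgf_like_derivable : forall l, psi_idom lmax l -> derivable psi l 1;
  cgf_like_derivable2 : forall l, psi_idom lmax l ->
    derivable (derive1 psi) l 1;
  cgf_like_C2 : forall l, psi_idom lmax l ->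
    {for l, continuous (derive1 (derive1 psi))};
  cgf_like_0 : psi 0 = 0;
  cgf_like_d0 : (psi h - psi 0) / h @[h --> 0^'+] --> 0;
  cgf_like_sup : ereal_sup [set (psi l)%:E | l in psi_dom lmax] = +oo%E }.

(* The endpoint value psi'(0+) = 0 is left out: [derive1 psi 0] is two-sided and
   psi' is increasing on (0, lmax), so the supremum is the same. *)
Definition bbar lmax psi : \bar R :=
  ereal_sup [set (derive1 psi l)%:E | l in psi_idom lmax].

(* The real-valued [sup] is the true supremum for every [u < bbar lmax psi]
   (the set is then nonempty and bounded), hence for every [u] when [bbar] is
   infinite; likewise for [slope_inv] below at [u > 0]. *)
Definition psi_star lmax psi (u : R) : R :=
  sup [set l * u - psi l | l in psi_dom lmax].

Definition slope_inv lmax psi (u : R) : R :=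
  sup [set l | psi_idom lmax l /\ psi l / l <= u].

Definition slope_tr lmax psi (u : R) : R :=
  psi (derive1 (psi_star lmax psi) u) / derive1 (psi_star lmax psi) u.

End Psi.

Definition ratio_event (T : Type) (R : realType) (k : time_kind)
    (S V : R -> T -> R) (alpha beta m x : R) : set T :=
  [set w | exists t, [/\ pos_times k t, m <= V t w &
                         x <= S t w / (alpha + beta * V t w)]].

(* Main.v *)
(* On the event, for every [l] with [psi l / l <= beta x], the process
   [exp (l S - psi l V)] reaches the level [exp (l x (alpha + beta m) - m psi l)],
   so Ville's inequality for the dominating supermartingale bounds the
   probability by [l0] over that level; the two cases optimize over [l].
   In continuous time the supermartingale itself need not be right-continuous:
   since [S] and [V] are, the exponential process exceeds any strictly smaller
   level at a rational time, and a union over countably many times remains. *)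
Require Import Defs.
From HB Require Import structures.
From mathcomp Require Import all_boot all_order all_algebra.
From mathcomp Require Import all_classical all_reals all_analysis.
From mathcomp Require Import ring lra.
Import Order.TTheory GRing.Theory Num.Theory.
Import numFieldNormedType.Exports.

Set Implicit Arguments.
Unset Strict Implicit.
Unset Printing Implicit Defensive.

Local Open Scope classical_set_scope.
Local Open Scope ring_scope.

(** * Ville's inequality along countably many times *)

(** Removing the null set [N] changes neither integral, and off [N] the inequality holds
    pointwise. *)
Lemma ae_le_integral d (T : measurableType d) (R : realType)
    (mu : {measure set T -> \bar R}) (D : set T) (f g : T -> \bar R) :
  measurable D -> mu.-integrable D f -> mu.-integrable D g ->
  {ae mu, forall w, (f w <= g w)%E} ->
  (\int[mu]_(w in D) f w <= \int[mu]_(w in D) g w)%E.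
Proof.
move=> mD fi gi [N [mN N0 fgN]].
rewrite (negligible_integral mN mD fi N0) (negligible_integral mN mD gi N0).
have mDN : measurable (D `\` N) by exact: measurableD.
apply: le_integral => //; try exact: (integrableS mD).
move=> w; rewrite inE => -[_ Nw].
by apply: contrapT => fg; apply: Nw; exact: fgN.
Qed.

Lemma integral_setID d (T : measurableType d) (R : realType)
    (mu : {measure set T -> \bar R}) (f : T -> \bar R) (C A : set T) :
  mu.-integrable setT f -> measurable C -> measurable A ->
  (\int[mu]_(w in C) f w =
   \int[mu]_(w in C `&` A) f w + \int[mu]_(w in C `\` A) f w)%E.
Proof.
move=> fi mC mA; rewrite -integral_setU.
- by rewrite setUIDK.
- exact: measurableI.
- exact: measurableD.
- by apply: (measurable_funS measurableT) => //; exact: (measurable_int mu).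
- by rewrite /disj_set setDE setIACA setICr setI0.
Qed.

Lemma sigma_algebra_setI (T : Type) (G : set_system T) (A B : set T) :
  sigma_algebra setT G -> G A -> G B -> G (A `&` B).
Proof. by move=> /(sigma_algebraP (fun _ _ => @subsetT _ _)) [_ _ _]; exact. Qed.

Lemma sigma_algebra_setD (T : Type) (G : set_system T) (A B : set T) :
  sigma_algebra setT G -> G A -> G B -> G (A `\` B).
Proof.
move=> sG GA GB; rewrite setDE; apply: sigma_algebra_setI => //.
by rewrite -setTD; case: sG => _ + _; exact.
Qed.

Lemma times0 (R : realType) (k : time_kind) : times k (0 : R).
Proof. by case: k => //=; exists 0%N. Qed.

Section Ville.
Context d (T : measurableType d) (R : realType) (P : probability T R).
Variables (k : time_kind) (F : R -> set_system T) (L : R -> T -> R).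
Hypotheses (Ffil : is_filtration k F) (Lsup : supermartingale P k F L).
Hypothesis L_ge0 : forall t, pos_times k t -> {ae P, forall w, 0 <= L t w}.

Let exceeds (a : R) (ts : seq R) : set T :=
  [set w | exists2 t, t \in ts & a < L t w].

Lemma exceeds_cons a t ts :
  exceeds a (t :: ts) = [set w | a < L t w] `|` exceeds a ts.
Proof.
apply/seteqP; split => w /=.
- by move=> [s]; rewrite inE => /orP[/eqP->|sts] ?; [left|right; exists s].
- case=> [?|[s sts ?]]; first by exists t => //; rewrite mem_head.
  by exists s => //; rewrite inE sts orbT.
Qed.

Lemma filtration_gt a t : times k t -> F t [set w | a < L t w].
Proof.
move=> kt; have := supermartingale_adapted Lsup kt.
move=> /(_ `]a, +oo[%classic (measurable_itv _)).
by congr (F t); apply/seteqP; split => w /=; rewrite in_itv/= andbT.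
Qed.

Lemma measurable_gt a t : times k t -> measurable [set w | a < L t w].
Proof. by move=> kt; apply: (filtration_measurable Ffil kt); exact: filtration_gt. Qed.

Lemma measurable_exceeds a ts :
  (forall t, t \in ts -> pos_times k t) -> measurable (exceeds a ts).
Proof.
elim: ts => [|t ts IH] kts.
  by rewrite (_ : exceeds a [::] = set0)//; apply/seteqP; split => w // -[].
rewrite exceeds_cons; apply: measurableU.
  by apply: measurable_gt; have [] := kts _ (mem_head t ts).
by apply: IH => s sts; apply: kts; rewrite inE sts orbT.
Qed.

(** On [C] in [F s] the conditional expectation [Y] has the same integral as [L t], and [Y <= L s]
    almost surely. *)
Lemma supermartingale_le_integral s t C : times k s -> times k t -> s <= t -> F s C ->
  (\int[P]_(w in C) (L t w)%:E <= \int[P]_(w in C) (L s w)%:E)%E.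
Proof.
move=> ks kt st FC; have mC := filtration_measurable Ffil ks FC.
have [Y [Yi _ YC] Yle] := supermartingale_le Lsup ks kt st.
rewrite -YC//; apply: ae_le_integral => //.
- exact: (integrableS measurableT).
- by apply: (integrableS measurableT) => //; exact: (supermartingale_integrable Lsup).
Qed.

Lemma integral_setI_gt_ge a s C : pos_times k s -> measurable C ->
  (a%:E * P (C `&` [set w | (a < L s w)%R]) <=
   \int[P]_(w in C `&` [set w | (a < L s w)%R]) (L s w)%:E)%E.
Proof.
move=> [ks s0] mC; set A := [set w | _].
have mCA : measurable (C `&` A) by apply: measurableI => //; exact: measurable_gt.
rewrite -integral_cst//; apply: le_integral => //.
- exact: finite_measure_integrable_cst.
- by apply: (integrableS measurableT) => //; exact: (supermartingale_integrable Lsup).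
- by move=> w; rewrite inE => -[_ /ltW]; rewrite lee_fin.
Qed.

Lemma supermartingale_integral_ge0 s C : pos_times k s -> measurable C ->
  (0 <= \int[P]_(w in C) (L s w)%:E)%E.
Proof.
move=> ks mC; rewrite -(integral0 P C); apply: ae_le_integral => //.
- exact: integrable0.
- apply: (integrableS measurableT) => //.
  by case: ks => + _; exact: (supermartingale_integrable Lsup).
- by apply: filterS (L_ge0 ks) => w /=; rewrite lee_fin.
Qed.

(* Splitting off the first time of exceedance: on [C] minus the set where
   [L s] exceeds [a], the induction hypothesis applies from the next time on. *)
Lemma ville_seq a ts s C : path <=%R s ts ->
  (forall t, t \in s :: ts -> pos_times k t) -> F s C ->
  (a%:E * P (C `&` exceeds a (s :: ts)) <= \int[P]_(w in C) (L s w)%:E)%E.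
Proof.
elim: ts s C => [|t ts IH] s C pts kts FC.
all: have pks := kts _ (mem_head _ _); have [ks s0] := pks.
all: have mC := filtration_measurable Ffil ks FC.
all: set A := [set w | a < L s w]; have mA : measurable A by exact: measurable_gt.
all: have mCA : measurable (C `&` A) by exact: measurableI.
all: have mCDA : measurable (C `\` A) by exact: measurableD.
all: rewrite (integral_setID (supermartingale_integrable Lsup ks) mC mA).
all: rewrite exceeds_cons -/A.
- rewrite (_ : exceeds a [::] = set0) ?setU0; last first.
    by apply/seteqP; split => w // -[].
  (* No time is left after [s]: nonnegativity discards the integral over [C] minus [A]. *)
  by rewrite -[leLHS]adde0; apply: leeD; [exact: integral_setI_gt_ge|exact: supermartingale_integral_ge0].
- move: pts => /= /andP[st pts].
  have kts' r : r \in t :: ts -> pos_times k r.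
    by move=> rts; apply: kts; rewrite inE rts orbT.
  have [kt t0] := kts' _ (mem_head _ _).
  (* [C] minus [A] belongs to [F s], hence to [F t], so it can serve as the new [C]. *)
  have FCDA : F s (C `\` A).
    by apply: sigma_algebra_setD => //; [exact: (filtration_sigma Ffil)|exact: filtration_gt].
  have FtCDA := filtration_mono Ffil ks kt st FCDA.
  have mX := measurable_exceeds a kts'.
  rewrite (_ : C `&` (A `|` _) =
    (C `&` A) `|` ((C `\` A) `&` exceeds a (t :: ts))); last first.
    apply/seteqP; split => w /=.
      by case=> Cw; have [Aw|Aw] := pselect (A w); [left|case=> // ?; right].
    by case=> [[? ?]|[[? ?] ?]]; split => //; [left|right].
  rewrite measureU//; last 2 first.
  + exact: measurableI.
  + by apply/seteqP; split => w //= [[_ ?]] [[_ ?]].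
  rewrite muleDr// ?ge0_adde_def ?inE//.
  apply: leeD; first exact: integral_setI_gt_ge.
  apply: le_trans (supermartingale_le_integral ks kt st FCDA).
  exact: IH.
Qed.

(** Sorting does not change [exceeds]. Take [C = setT] at the earliest time; the integral of [L]
    there is at most that of [L 0], hence at most [l0]. *)
Lemma ville_seq_unsorted (a l0 : R) ts : (0 <= l0)%R -> {ae P, forall w, L 0 w <= l0} ->
  (forall t, t \in ts -> pos_times k t) ->
  (a%:E * P (exceeds a ts) <= l0%:E)%E.
Proof.
have k0 := times0 R k; move=> l00 L0 kts.
pose rs := sort <=%R ts.
have -> : exceeds a ts = exceeds a rs.
  by apply/seteqP; split => w [t tts at_]; exists t => //; move: tts; rewrite mem_sort.
have {kts} krs t : t \in rs -> pos_times k t by rewrite mem_sort => /kts.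
have : sorted <=%R rs by apply: sort_sorted; exact: le_total.
case: rs krs => [|s rs] krs /= prs.
  rewrite (_ : exceeds a [::] = set0) ?measure0 ?mule0 ?lee_fin//.
  by apply/seteqP; split => w // -[].
have [ks s0] := krs _ (mem_head _ _).
have FT t : times k t -> F t setT.
  move=> kt; rewrite -(setD0 setT).
  by case: (filtration_sigma Ffil kt) => ? + _; exact.
have := ville_seq a prs krs (FT _ ks); rewrite setTI => /le_trans; apply.
apply: le_trans (supermartingale_le_integral k0 ks (ltW s0) (FT _ k0)) _.
have -> : l0%:E = (\int[P]_(w in setT) (cst l0%:E w))%E.
  by rewrite integral_cst; [rewrite [X in (_ * X)%E]probability_setT mule1|].
apply: ae_le_integral => //.
- exact: (supermartingale_integrable Lsup).
- exact: finite_measure_integrable_cst.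
Qed.

(** The events [E n] of exceedance at one of the first [n] times increase to the whole event, so
    continuity from below applies; [g] may list the times in any order. *)
Lemma ville_countable (a l0 : R) (g : nat -> R) : 0 < a -> 0 <= l0 ->
  {ae P, forall w, L 0 w <= l0} -> (forall n, pos_times k (g n)) ->
  measurable [set w | exists n, a < L (g n) w] /\
  (P [set w | exists n, (a < L (g n) w)%R] <= (l0 / a)%:E)%E.
Proof.
move=> a0 l00 L0 kg.
pose E n := exceeds a (map g (iota 0 n)).
have kgn n t : t \in map g (iota 0 n) -> pos_times k t by move=> /mapP[i _ ->].
have mE n : measurable (E n) by exact/measurable_exceeds/kgn.
have -> : [set w | exists n, a < L (g n) w] = \bigcup_n E n.
  apply/seteqP; split => w /=.
    move=> [n an]; exists n.+1 => //; exists (g n) => //.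
    by apply/mapP; exists n => //; rewrite mem_iota ltnSn.
  by move=> [n _ [t /mapP[i _ ->] ai]]; exists i.
split; first exact: bigcupT_measurable.
have ndE : nondecreasing_seq E.
  move=> m n mn; apply/subsetPset => w [t /mapP[i im ->] ai]; exists (g i) => //.
  apply/mapP; exists i => //; move: im; rewrite !mem_iota !add0n => im.
  exact: leq_trans im mn.
have cE := nondecreasing_cvg_mu (mu := P) mE (bigcupT_measurable _ mE) ndE.
rewrite -(cvg_lim _ cE)//; apply: lime_le; first by apply/cvg_ex; eexists; exact: cE.
apply: nearW => n /=; rewrite EFinM muleC lee_pdivlMl//.
by apply: ville_seq_unsorted => // t /kgn.
Qed.
End Ville.

Lemma countable_dense_times (R : realType) (k : time_kind) :
  exists g : nat -> R, [/\ forall n, pos_times k (g n),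
    k = DiscreteTime -> forall t, pos_times k t -> exists n, g n = t &
    k = ContinuousTime -> forall a b, 0 <= a -> a < b ->
      exists n, a < g n < b].
Proof.
case: k.
(* The shift skips time 0, which is not a positive time. *)
- exists (fun n => n.+1%:R); split => //.
    by move=> n; split; [exists n.+1|rewrite ltr0n].
  by move=> _ t [[[|n] _ <-]]; rewrite ?ltxx// => _; exists n.
(* [q] enumerates the rationals, with 1 for invalid codes; nonpositive values are also replaced by
   1, so that all times are positive. *)
- pose q n := if (unpickle n : option rat) is Some r then r else 1%Q.
  exists (fun n => if 0 < ratr (q n) :> R then ratr (q n) else 1); split => //.
    by move=> n; case: ifP => q0; split => //=; rewrite ?ltW.
  move=> _ a b a0 ab; have [r] := rat_in_itvoo ab; rewrite in_itv/= => /andP[ar rb].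
  exists (pickle r); rewrite /q pickleK (le_lt_trans a0 ar).
  by rewrite ar rb.
Qed.

(** * Crossing probabilities of sub-psi processes *)

Section Crossing.
Context d (T : measurableType d) (R : realType) (P : probability T R).
Variables (k : time_kind) (F : R -> set_system T) (S V : R -> T -> R).
Variables (l0 : R) (lmax : \bar R) (psi : R -> R).
Hypotheses (hstd : standing P k F S V) (hl0 : 1 <= l0).
Hypothesis hsub : sub_psi P k F l0 lmax psi S V.

(** In continuous time, right-continuity of the paths keeps the process above [c'] just after [t],
    where some [g n] lies; the gap [c' < c] makes this an open condition. In discrete time some
    [g n] equals [t]. *)
Lemma crossing_at_dense_time (g : nat -> R) (l p c c' : R) w :
  (k = DiscreteTime -> forall t, pos_times k t -> exists n, g n = t) ->
  (k = ContinuousTime -> forall a b, 0 <= a -> a < b -> exists n, a < g n < b) ->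
  c' < c -> (exists2 t, pos_times k t & c <= l * S t w - p * V t w) ->
  exists n, c' < l * S (g n) w - p * V (g n) w.
Proof.
move=> gD gC cc' [t kt ct].
have {}ct := lt_le_trans cc' ct.
have [kD|kC] : k = DiscreteTime \/ k = ContinuousTime by case: (k); [left|right].
  by have [n gnt] := gD kD t kt; exists n; rewrite gnt.
have [_ _ _ _ /(_ kC)[_ _ /(_ w)[[Sr _] [Vr _]]]] := hstd.
have t0 : 0 <= t by case: kt => _ /ltW.
have fr : l * S s w - p * V s w @[s --> t^'+] --> l * S t w - p * V t w.
  by apply: cvgB; apply: cvgMr; [exact: Sr|exact: Vr].
have /cvgr_gt/(_ _ ct) := fr.
rewrite near_withinE => -[e /= e0 He].
have te : t < t + e by rewrite ltrDl.
have [n /andP[tg ge]] := gC kC _ _ t0 te.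
exists n; apply: He => //=.
by rewrite ltr_distlC; apply/andP; split => //; lra.
Qed.

(** [E] may be nonmeasurable, but it is covered by the event that [L] exceeds [expR c'] along [g],
    together with a null set. *)
Lemma crossing_bound_lt (E : set T) (l c c' : R) : psi_dom lmax l -> c' < c ->
  (forall w, E w -> exists2 t, pos_times k t & c <= l * S t w - psi l * V t w) ->
  (outer_prob P E <= (l0 * expR (- c'))%:E)%E.
Proof.
move=> hl cc' hE.
have [L [Lsup L0 Lge]] := hsub hl.
have [g [kg gD gC]] := countable_dense_times R k.
have [Ffil _ _ _ _] := hstd.
have Lge0 t : pos_times k t -> {ae P, forall w, 0 <= L t w}.
  by move=> /Lge; apply: filterS => w; apply: le_trans; exact: expR_ge0.
have l00 : 0 <= l0 by exact: le_trans ler01 hl0.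
have [mA PA] := ville_countable Ffil Lsup Lge0 (expR_gt0 c') l00 L0 kg.
(* The null set where domination fails depends on the time; along [g] the countably many null sets
   merge into one [N]. *)
have [N [mN N0 hN]] := negligible_bigcup (fun n => Lge _ (kg n)).
set A := [set w | _] in mA PA.
have EAN : E `<=` A `|` N.
  move=> w Ew; have [n cn] := crossing_at_dense_time gD gC cc' (hE w Ew).
  have [Nw|Nw] := pselect (N w); [by right|left].
  exists n; apply: lt_le_trans (_ : expR (l * S (g n) w - psi l * V (g n) w) <= _).
    by rewrite ltr_expR.
  by apply: contrapT => h; apply: Nw; apply: hN; exists n.
have mAN : measurable (A `|` N) by exact: measurableU.
apply: (le_trans (le_mu_ext P EAN)).
rewrite measurable_mu_extE// expRN; apply: le_trans PA.
apply: (@le_trans _ _ (P A + P N)%E); first exact: measureU2.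
by rewrite (N0 : P N = 0%E) adde0.
Qed.

Lemma outer_prob_le_exp (E : set T) (c : R) :
  (forall c', c' < c -> (outer_prob P E <= (l0 * expR (- c'))%:E)%E) ->
  (outer_prob P E <= (l0 * expR (- c))%:E)%E.
Proof.
move=> h; apply/lee_addgt0Pr => e e0.
have l00 : 0 < l0 by exact: lt_le_trans ltr01 hl0.
(* [r] is chosen so that passing from [c] to [c - ln r] raises the bound by exactly [e]. *)
pose r := 1 + e / (l0 * expR (- c)).
have q0 : 0 < l0 * expR (- c) by rewrite mulr_gt0// expR_gt0.
have r1 : 1 < r by rewrite ltrDl divr_gt0.
have := h (c - ln r) _; rewrite ltrBlDr ltrDl ln_gt0// => /(_ isT) /le_trans; apply.
rewrite lee_fin opprB expRD lnK ?posrE; last lra.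
suff -> : l0 * (r * expR (- c)) = l0 * expR (- c) + e by [].
by rewrite /r; field; apply/andP; split; rewrite gt_eqF ?expR_gt0.
Qed.

Lemma crossing_bound (E : set T) (l c : R) : psi_dom lmax l ->
  (forall w, E w -> exists2 t, pos_times k t & c <= l * S t w - psi l * V t w) ->
  (outer_prob P E <= (l0 * expR (- c))%:E)%E.
Proof.
by move=> hl hE; apply: outer_prob_le_exp => c' cc'; exact: (crossing_bound_lt hl cc').
Qed.

(** * Crossing of the boundary [x * (alpha + beta * V)] *)

Variables alpha beta m x : R.
Hypotheses (beta0 : 0 < beta) (alpha0 : 0 <= alpha) (m0 : 0 <= m).
Hypothesis alpha_or_m : 0 < alpha \/ 0 < m.

Lemma ratio_event_bound (l : R) : psi_dom lmax l -> psi l <= l * (beta * x) ->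
  (outer_prob P (ratio_event k S V alpha beta m x) <=
   (l0 * expR (- (l * x * (alpha + beta * m) - m * psi l)))%:E)%E.
Proof.
move=> hl psil; apply: (crossing_bound hl) => w [t [kt mV xS]].
exists t => //.
have V0 : 0 < alpha + beta * V t w.
  case: alpha_or_m => h.
    by apply: ltr_wpDr h; rewrite mulr_ge0 ?(ltW beta0)// (le_trans m0).
  by apply: ltr_wpDl => //; rewrite mulr_gt0// (lt_le_trans h).
move: xS; rewrite ler_pdivlMr// => xS.
have l_ge0 : 0 <= l by case: hl.
have := ler_wpM2l l_ge0 xS.
(* This makes [l * x * (alpha + beta * V) - psi l * V] at least its value at [V = m]. *)
have : 0 <= (l * (beta * x) - psi l) * (V t w - m) by rewrite mulr_ge0// subr_ge0.
by nra.
Qed.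

End Crossing.

(** * The Legendre transform of a CGF-like function *)

Lemma derivable_linear_approx (R : realType) (f : R -> R) (x e : R) :
  derivable f x 1 -> 0 < e -> exists2 r : R, 0 < r &
    forall h, h != 0 -> `|h| < r ->
      `|f (x + h) - f x - derive1 f x * h| <= e * `|h|.
Proof.
move=> fx e0; have /cvgrPdist_lt/(_ _ e0) := fx.
rewrite near_withinE => -[r /= r0 Hr]; exists r => // h h0 hr.
have := Hr h; rewrite /= sub0r normrN => /(_ hr h0).
rewrite -/('D_1 f x) -derive1E [h%:A]mulr1 (addrC h x) => /ltW H.
rewrite -ler_pdivrMr ?normr_gt0// -normf_div distrC in H *.
by move: H; congr (`|_| <= _); rewrite [_ *: _]mulrC; field.
Qed.

(** Gives the derivative of [psi_star] from an estimate of its increments, without differentiability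
    known beforehand. *)
Lemma derive1_linear_approx (R : realType) (f : R -> R) (x v : R) :
  (forall e, 0 < e -> exists2 r : R, 0 < r &
    forall h, h != 0 -> `|h| < r -> `|f (x + h) - f x - v * h| <= e * `|h|) ->
  derive1 f x = v.
Proof.
move=> H; apply/cvg_lim => //; apply/cvgrPdist_le => e e0.
have [r r0 Hr] := H e e0.
rewrite near_withinE; exists r => //= h; rewrite /= sub0r normrN => hr h0.
have := Hr h h0 hr; rewrite -ler_pdivrMr ?normr_gt0// -normf_div distrC addrC.
by congr (`|_| <= _); rewrite [_ *: _]mulrC (addrC h); field.
Qed.

(** At [x + t * (y - x)] the chord lies above [f], and [f] lies above its linear approximation up to
    an error [t * e]; divide by [t]. *)
Lemma strictly_convex_on_tangent (R : realType) (D : set R) (f : R -> R) (x y : R) :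
  strictly_convex_on D f -> D x -> D y -> derivable f x 1 ->
  f x + derive1 f x * (y - x) <= f y.
Proof.
move=> cf Dx Dy fx; have [->|yx] := eqVneq y x.
  by rewrite subrr mulr0 addr0.
apply/ler_addgt0Pr => e e0.
have a0 : 0 < `|y - x| by rewrite normr_gt0 subr_eq0.
have [r r0 Hr] := derivable_linear_approx fx (divr_gt0 e0 a0).
(* The first bound gives [t < 1] for convexity, the second puts [t * (y - x)] within the radius
   [r]. *)
pose t := Num.min (2^-1) (r / (2 * `|y - x|)).
have t0 : 0 < t by rewrite lt_min invr_gt0 ltr0n divr_gt0// mulr_gt0.
have t1 : t < 1 by rewrite gt_min; apply/orP; left; lra.
have tr : t * `|y - x| < r.
  have : t <= r / (2 * `|y - x|) by rewrite ge_min lexx orbT.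
  rewrite ler_pdivlMr ?mulr_gt0// => ?; nra.
have := cf y x t Dy Dx yx t0 t1.
have h0 : t * (y - x) != 0 by rewrite mulf_neq0 ?subr_eq0// lt0r_neq0.
have := Hr _ h0; rewrite normrM (gtr0_norm t0) => /(_ tr).
rewrite [_ * (t * `|_|)]mulrCA divfK ?lt0r_neq0// ler_norml => /andP[H _].
rewrite (_ : t * y + (1 - t) * x = x + t * (y - x)); last by ring.
move=> H'; rewrite -(ler_pM2l t0); lra.
Qed.

(** * Slopes, maximizers and conjugate of [psi] *)

Section PsiTheory.
Context (R : realType) (lmax : \bar R) (psi : R -> R).
Hypotheses (lmax_gt0 : (0 < lmax)%E) (psi_cgf : cgf_like lmax psi).
Hypothesis bbar_infty : bbar lmax psi = +oo%E.

Let psi_dom_le a b : 0 <= a -> a <= b -> psi_dom lmax b -> psi_dom lmax a.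
Proof. by move=> a0 ab [_ bl]; split => //; apply: le_lt_trans bl; rewrite lee_fin. Qed.

Let psi_idomE a : psi_idom lmax a <-> 0 < a /\ psi_dom lmax a.
Proof.
by split => [[a0 al]|[a0 [_ al]]]; split => //; split => //; exact: ltW.
Qed.

Let psi_dom0 : psi_dom lmax 0. Proof. by split. Qed.

Let psi_dom_right l : psi_dom lmax l -> exists2 e, 0 < e & psi_dom lmax (l + e).
Proof.
case: (lmax) => [r|[l0 _]|[]//]; last first.
  by exists 1 => //; split; rewrite ?ltry ?addr_ge0.
move=> [l0]; rewrite lte_fin => lr; exists ((r - l) / 2); first lra.
by split; rewrite ?lte_fin; lra.
Qed.

Lemma psi_tangent l y : psi_idom lmax l -> psi_dom lmax y ->
  psi l + derive1 psi l * (y - l) <= psi y.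
Proof.
move=> hl hy; apply: (strictly_convex_on_tangent (cgf_like_convex psi_cgf)) => //.
  by have [] := (psi_idomE l).1 hl.
exact: (cgf_like_derivable psi_cgf).
Qed.

(** Strictness comes from the tangent inequality at the midpoint [z], combined with strict convexity
    between [y] and [l]. *)
Lemma psi_tangent_lt l y : psi_idom lmax l -> psi_dom lmax y -> y != l ->
  psi l + derive1 psi l * (y - l) < psi y.
Proof.
move=> hl hy yl; have [l0 dl] := (psi_idomE l).1 hl.
have y0 : 0 <= y by case: hy.
pose z := 2^-1 * y + (1 - 2^-1) * l.
have dz : psi_dom lmax z.
  by have [yl'|ly] := leP y l; [apply: psi_dom_le dl|apply: psi_dom_le hy];
    rewrite /z; lra.
have h1 : 0 < 2^-1 :> R by lra.
have h2 : 2^-1 < 1 :> R by lra.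
have := cgf_like_convex psi_cgf hy dl yl h1 h2; rewrite -/z.
have := psi_tangent hl dz; rewrite /z; lra.
Qed.

(** Add the strict tangent inequalities at [a] and at [b]. *)
Lemma psi_derive_lt a b : psi_idom lmax a -> psi_idom lmax b -> a < b ->
  derive1 psi a < derive1 psi b.
Proof.
move=> ha hb ab.
have [_ da] := (psi_idomE a).1 ha; have [_ db] := (psi_idomE b).1 hb.
have := psi_tangent_lt ha db; rewrite (gt_eqF ab) => /(_ isT).
have := psi_tangent_lt hb da; rewrite (lt_eqF ab) => /(_ isT).
nra.
Qed.

Lemma psi_near0 u : 0 < u ->
  exists2 r, 0 < r & forall h, 0 < h -> h < r -> psi_idom lmax h /\ `|psi h| < u * h.
Proof.
move=> u0; have /cvgrPdist_lt/(_ _ u0) := cgf_like_d0 psi_cgf.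
rewrite near_withinE => -[r /= r0 Hr].
have [e e0 de] := psi_dom_right psi_dom0; rewrite add0r in de.
exists (Num.min r e); first by rewrite lt_min r0.
move=> h h0; rewrite lt_min => /andP[hr he]; split.
  by apply/psi_idomE; split => //; apply: psi_dom_le de; exact: ltW.
have := Hr h; rewrite /= sub0r normrN gtr0_norm// => /(_ hr h0).
rewrite (cgf_like_0 psi_cgf) subr0 sub0r normrN normf_div (gtr0_norm h0).
by rewrite ltr_pdivrMr.
Qed.

(** Intermediate values of [psi']: it falls below [v] near 0, and exceeds [v] somewhere because
    [bbar] is infinite. *)
Lemma psi_derive_surj v : 0 < v -> exists2 l, psi_idom lmax l & derive1 psi l = v.
Proof.
move=> v0.
have [a ha av] : exists2 a, psi_idom lmax a & derive1 psi a < v.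
  (* With [a = r / 3], the tangent at [a] read at [2 * a] gives [a * psi' a <= psi (2 * a) - psi a],
     which is below [v / 3 * (2 * a + a) = v * a]. *)
  have v30 : 0 < v / 3 by lra.
  have [r r0 Hr] := psi_near0 v30; exists (r / 3); first by apply: (Hr _ _ _).1; lra.
  have [|//|ha] := Hr (r / 3); [lra|lra|].
  have [|//|hb] := Hr (2 * (r / 3)); [lra|lra|].
  rewrite !ltr_norml => /andP[_ h2] /andP[h1 _].
  have := psi_tangent ha ((psi_idomE _).1 hb).2.
  nra.
have [b hb vb] : exists2 b, psi_idom lmax b & v < derive1 psi b.
  have : (v%:E < bbar lmax psi)%E by rewrite bbar_infty ltry.
  by move=> /ereal_sup_gt[_ [b hb <-]]; rewrite lte_fin; exists b.
have ab : a < b.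
  rewrite ltNge; apply/negP; rewrite le_eqVlt => /predU1P[bE|ba].
    by move: av vb; rewrite bE; lra.
  by have := psi_derive_lt hb ha ba; lra.
have hab l : l \in `[a, b] -> psi_idom lmax l.
  rewrite in_itv/= => /andP[al lb]; apply/psi_idomE.
  have l0 : 0 < l by apply: lt_le_trans al; case: ha.
  by split => //; apply: psi_dom_le ((psi_idomE b).1 hb).2; rewrite // ltW.
have [|||l /hab hl <-] := @IVT R (derive1 psi) a b v; last by exists l.
- exact: ltW.
- by apply: derivable_within_continuous => l /hab; exact: (cgf_like_derivable2 psi_cgf).
- by rewrite ge_min le_max (ltW av) (ltW vb) orbT.
Qed.

(** The tangent inequality at [l] says that [y * psi' l - psi y] is maximal at [y = l]. *)
Lemma psi_star_derive l : psi_idom lmax l ->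
  psi_star lmax psi (derive1 psi l) = l * derive1 psi l - psi l.
Proof.
move=> hl; have [l0 dl] := (psi_idomE l).1 hl.
have ub : ubound [set y * derive1 psi l - psi y | y in psi_dom lmax]
    (l * derive1 psi l - psi l).
  by move=> _ [y dy <-]; have := psi_tangent hl dy; lra.
apply/eqP; rewrite eq_le; apply/andP; split.
  by apply: ge_sup ub; exists (l * derive1 psi l - psi l); exists l.
by apply: ub_le_sup; [eexists; exact: ub|exists l].
Qed.

(** The Fenchel-Young inequality: [u] is a slope [psi' l], so the supremum is attained at [l]. *)
Lemma psi_star_ge u y : 0 < u -> psi_dom lmax y -> y * u - psi y <= psi_star lmax psi u.
Proof.
move=> u0 dy; have [l hl <-] := psi_derive_surj u0.
by rewrite psi_star_derive//; have := psi_tangent hl dy; lra.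
Qed.

(* The slope of [psi_star] between [v] and [v + h] lies between the maximizers
   at [v] and at [v + h], and the latter depends continuously on [h]. *)
Lemma derive1_psi_star l : psi_idom lmax l -> 0 < derive1 psi l ->
  derive1 (psi_star lmax psi) (derive1 psi l) = l.
Proof.
move=> hl; set v := derive1 psi l => v0; have [l0 dl] := (psi_idomE l).1 hl.
apply: derive1_linear_approx => e e0.
have [e' e'0 de'] := psi_dom_right dl.
(* [s <= e] controls the final error; the other two bounds keep [l - s] and [l + s] inside the open
   domain. *)
pose s := Num.min e (Num.min e' (l / 2)).
have s0 : 0 < s by rewrite !lt_min e0 e'0; lra.
have [se se' sl] : [/\ s <= e, s <= e' & s <= l / 2].
  by rewrite /s; split; rewrite !ge_min lexx ?orbT.
have hp : psi_idom lmax (l + s).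
  by apply/psi_idomE; split; [lra|apply: psi_dom_le de'; lra].
have hm : psi_idom lmax (l - s).
  by apply/psi_idomE; split; [lra|apply: psi_dom_le dl; lra].
have vp : v < derive1 psi (l + s) by apply: psi_derive_lt => //; lra.
have vm : derive1 psi (l - s) < v by apply: psi_derive_lt => //; lra.
(* This radius keeps [v + h] positive and between the slopes at [l - s] and [l + s], which traps its
   maximizer [k] in between. *)
exists (Num.min v (Num.min (derive1 psi (l + s) - v) (v - derive1 psi (l - s)))).
  by rewrite !lt_min v0 !subr_gt0 vp.
move=> h h0; rewrite !lt_min !ltr_norml => /and3P[/andP[hv _] /andP[_ h1] /andP[h2 _]].
have w0 : 0 < v + h by lra.
have [k hk kE] := psi_derive_surj w0.
have kp : k <= l + s.
  by rewrite leNgt; apply/negP => /(psi_derive_lt hp hk); lra.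
have km : l - s <= k.
  by rewrite leNgt; apply/negP => /(psi_derive_lt hk hm); lra.
have := psi_star_derive hk; rewrite kE => ->; rewrite psi_star_derive// -/v.
(* The tangents at [k] and at [l] squeeze the error [A] between 0 and [(k - l) * h]. *)
have := psi_tangent hk dl; rewrite kE => T1.
have := psi_tangent hl ((psi_idomE k).1 hk).2; rewrite -/v => T2.
set A := _ - _ - l * h.
have A0 : 0 <= A by rewrite /A; lra.
have A1 : A <= (k - l) * h by rewrite /A; lra.
rewrite ger0_norm//; apply: le_trans A1 _; apply: le_trans (ler_norm _) _.
by rewrite normrM ler_wpM2r// ler_norml; apply/andP; split; lra.
Qed.

(** * The inverse slope [slope_inv] and the comparison of exponents *)

Lemma slope_set_ubound u : 0 < u ->
  has_ubound [set l | psi_idom lmax l /\ psi l / l <= u].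
Proof.
move=> u0.
have : ((u + 1)%:E < bbar lmax psi)%E by rewrite bbar_infty ltry.
move=> /ereal_sup_gt[_ [b hb <-]]; rewrite lte_fin => ub.
have bu : 0 < derive1 psi b - u by lra.
(* The abscissa where the tangent at [b], steeper than [u], meets the line of slope [u] through the
   origin. *)
exists ((derive1 psi b * b - psi b) / (derive1 psi b - u)) => l [hl].
have [l0 dl] := (psi_idomE l).1 hl.
rewrite ler_pdivrMr// ler_pdivlMr// => lu.
by have := psi_tangent hb dl; nra.
Qed.

Lemma slope_inv_ge u l : 0 < u -> psi_idom lmax l -> psi l <= u * l ->
  l <= slope_inv lmax psi u.
Proof.
move=> u0 hl lu; apply: ub_le_sup; first exact: slope_set_ubound.
by split => //; rewrite ler_pdivrMr//; case: hl.
Qed.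

Lemma slope_inv_gt u c : 0 < u -> c < slope_inv lmax psi u ->
  exists2 l, psi_idom lmax l /\ psi l <= u * l & c < l.
Proof.
move=> u0 /sup_gt[].
  (* Points near 0 make the set nonempty, as the real-valued [sup] requires. *)
  have [r r0 Hr] := psi_near0 u0; have [||h] := Hr (r / 2); [lra|lra|].
  rewrite ltr_norml => /andP[_ /ltW ?]; exists (r / 2); split => //.
  by rewrite ler_pdivrMr//; lra.
move=> l [hl lu] cl; exists l => //; split => //.
by move: lu; rewrite ler_pdivrMr//; case: hl.
Qed.

(** By strict convexity and [psi 0 = 0], the ratio [psi y / y] is strictly increasing, so no [y > l]
    lies in the set. *)
Lemma slope_inv_le u l : 0 < u -> psi_idom lmax l -> u * l <= psi l ->
  slope_inv lmax psi u <= l.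
Proof.
move=> u0 hl lu; rewrite leNgt; apply/negP => /(slope_inv_gt u0)[y [hy yu] ly].
have [l0 _] := hl; have [y0 dy] := (psi_idomE y).1 hy.
have t0 : 0 < l / y by rewrite divr_gt0.
have t1 : l / y < 1 by rewrite ltr_pdivrMr// mul1r.
have := cgf_like_convex psi_cgf dy psi_dom0 (lt0r_neq0 y0) t0 t1.
rewrite (cgf_like_0 psi_cgf) !mulr0 !addr0 divfK ?lt0r_neq0// => H.
have : l / y * psi y <= l / y * (u * y) by rewrite ler_wpM2l// ltW.
rewrite (_ : l / y * (u * y) = u * l); last by field; exact: lt0r_neq0.
lra.
Qed.

(** A tangent inequality for [psi_star]: the maximizer [l] at [b] is the slope there, and it
    competes in the supremum at [b + a / m]. *)
Lemma psi_star_line_le a b m : 0 <= a -> 0 < b -> 0 < m ->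
  m * psi_star lmax psi b + a * derive1 (psi_star lmax psi) b <=
  m * psi_star lmax psi (b + a / m).
Proof.
move=> a0 b0 m0; have [l hl lb] := psi_derive_surj b0.
have u0 : 0 < b + a / m by rewrite ltr_wpDr// divr_ge0// ltW.
have := psi_star_ge u0 ((psi_idomE l).1 hl).2.
rewrite -(ler_pM2l m0) (_ : m * (l * _ - _) = m * (l * b - psi l) + a * l); last first.
  by field; exact: lt0r_neq0.
have -> : derive1 (psi_star lmax psi) b = l by rewrite -lb derive1_psi_star ?lb.
by have -> : psi_star lmax psi b = l * b - psi l by rewrite -{1}lb psi_star_derive// lb.
Qed.

(* With [D := slope_inv b] and [f l := l * (m * b + a) - m * psi l], the left
   side is [f lb] and [f <= a * id] to the right of [D].  The concave [f] is
   maximal at [lu >= D], so [f >= f lb] on [D, lu]. *)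
Lemma psi_star_slope_inv_le a b m : 0 <= a -> 0 < b -> 0 <= m ->
  m = 0 \/ b <= slope_tr lmax psi (b + a / m) ->
  m * psi_star lmax psi b + a * derive1 (psi_star lmax psi) b <=
  a * slope_inv lmax psi b.
Proof.
move=> a0 b0 m_ge0 hm; have [lb hlb lbE] := psi_derive_surj b0.
have [lb0 dlb] := (psi_idomE lb).1 hlb.
have -> : derive1 (psi_star lmax psi) b = lb by rewrite -lbE derive1_psi_star ?lbE.
have -> : psi_star lmax psi b = lb * b - psi lb by rewrite -{1}lbE psi_star_derive// lbE.
(* The tangent at [lb], read at 0, gives [psi lb <= b * lb]. *)
have lbD : lb <= slope_inv lmax psi b.
  apply: slope_inv_ge => //.
  by have := psi_tangent hlb psi_dom0; rewrite (cgf_like_0 psi_cgf) lbE; lra.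
have [->|m_neq0] := eqVneq m 0; first by rewrite mul0r add0r ler_wpM2l.
have m0 : 0 < m by rewrite lt_neqAle eq_sym m_neq0.
case: hm => [m_eq0|]; first by rewrite m_eq0 eqxx in m_neq0.
have u0 : 0 < b + a / m by rewrite ltr_wpDr// divr_ge0.
have [lu hlu luE] := psi_derive_surj u0.
have [lu0 dlu] := (psi_idomE lu).1 hlu.
(* The case hypothesis becomes [b * lu <= psi lu]. *)
rewrite /slope_tr -{1 2}luE derive1_psi_star ?luE// ler_pdivlMr// => blu.
have Dlu : slope_inv lmax psi b <= lu by exact: slope_inv_le.
pose f l := l * (m * b + a) - m * psi l.
have muE : m * (b + a / m) = m * b + a by field.
have f_max : f lb <= f lu.
  have := psi_tangent hlu dlb; rewrite luE => /(ler_wpM2l m_ge0).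
  by rewrite mulrDr mulrA muE /f; lra.
have -> : m * (lb * b - psi lb) + a * lb = f lb by rewrite /f; ring.
apply/ler_addgt0Pr => e e0.
(* A point just right of [slope_inv b], capped at [lu]; the denominator [a + 1] bounds the cost
   [a * e / (a + 1)] by [e], also when [a = 0]. *)
pose l := Num.min lu (slope_inv lmax psi b + e / (a + 1)).
have a10 : 0 < a + 1 by lra.
have el0 : 0 < e / (a + 1) by rewrite divr_gt0.
have al : a * l <= a * slope_inv lmax psi b + e.
  have : l <= slope_inv lmax psi b + e / (a + 1) by rewrite ge_min lexx orbT.
  move=> /(ler_wpM2l a0)/le_trans; apply; rewrite mulrDr lerD2l.
  by rewrite mulrCA ger_pMr// ler_pdivrMr// mul1r; lra.
apply: le_trans al.
have [le_lu|lt_lu] := leP lu (slope_inv lmax psi b + e / (a + 1)).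
  rewrite /l min_l//; apply: le_trans f_max _.
  by have := ler_wpM2l m_ge0 blu; rewrite /f; lra.
have lE : l = slope_inv lmax psi b + e / (a + 1) by rewrite /l min_r// ltW.
have lb_l : lb < l by rewrite lE; lra.
have l_lu : l < lu by rewrite lE.
have dl : psi_dom lmax l by apply: psi_dom_le dlu; lra.
have l0 : 0 < l by lra.
have bl : b * l <= psi l.
  rewrite leNgt; apply/negP => /ltW H.
  by have := slope_inv_ge b0 ((psi_idomE l).2 (conj l0 dl)) H; lra.
apply: (@le_trans _ _ (f l)); last first.
  by have := ler_wpM2l m_ge0 bl; rewrite /f; lra.
have lt_b_u : lb < lu by lra.
(* The weight that writes [l] as a convex combination of [lb] and [lu], for the concavity of [f]. *)
pose t := (lu - l) / (lu - lb).
have t0 : 0 < t by rewrite divr_gt0; lra.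
have t1 : t < 1 by rewrite ltr_pdivrMr; lra.
have lt : t * lb + (1 - t) * lu = l by rewrite /t; field; lra.
have := cgf_like_convex psi_cgf dlb dlu _ t0 t1.
rewrite (lt_eqF lt_b_u) => /(_ isT).
rewrite lt -(ltr_pM2l m0) => H.
have : 0 <= (1 - t) * (f lu - f lb) by rewrite mulr_ge0; lra.
have -> : f l = l * (m * b + a) - m * psi l by [].
rewrite -[in X in _ -> _ <= X * _ - _]lt /f; lra.
Qed.

End PsiTheory.

(** * Crossing bounds in the general and sub-Gaussian cases *)

Theorem corollary7 (d : measure_display) (T : measurableType d) (R : realType)
    (P : probability T R) (k : time_kind) (F : R -> set_system T)
    (S V : R -> T -> R) (l0 : R)
    (hstd : standing P k F S V) (hl0 : 1 <= l0) :
  (forall (lmax : \bar R) (psi : R -> R),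
     (0 < lmax)%E -> cgf_like lmax psi -> bbar lmax psi = +oo%E ->
     sub_psi P k F l0 lmax psi S V ->
     forall alpha beta m x : R,
       0 < beta -> 0 < x -> 0 <= alpha -> 0 <= m -> 0 < alpha \/ 0 < m ->
       let u := x * (alpha + beta * m) / m in
       let rhs1 := l0 * expR (- (alpha * x * slope_inv lmax psi (beta * x))) in
       let rhs2 := l0 * expR (- (m * psi_star lmax psi u)) in
       let rhs3 := l0 * expR (- (m * psi_star lmax psi (beta * x))
                     - alpha * x * derive1 (psi_star lmax psi) (beta * x)) in
       (m = 0 \/ beta * x <= slope_tr lmax psi u ->
          (outer_prob P (ratio_event k S V alpha beta m x) <= rhs1%:E)%E /\
          rhs1 <= rhs3) /\
       (0 < m -> slope_tr lmax psi u <= beta * x ->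
          (outer_prob P (ratio_event k S V alpha beta m x) <= rhs2%:E)%E /\
          rhs2 <= rhs3)) /\
  (sub_psi P k F l0 +oo%E (fun l => l ^+ 2 / 2) S V ->
     forall alpha beta m x : R,
       0 < beta -> 0 < x -> 0 <= alpha -> 0 <= m -> 0 < alpha \/ 0 < m ->
       (outer_prob P (ratio_event k S V alpha beta m x) <=
         (l0 * expR (- (x ^+ 2 * (2 * alpha * beta +
            (beta * m - alpha) ^+ 2 * (alpha <= beta * m)%R%:R / (2 * m)))))%:E)%E).
Proof.
split.
- move=> lmax psi lmax0 hpsi hbar hsub al b m x b0 x0 al0 m0 hor u rhs1 rhs2 rhs3.
  have bx0 : 0 < b * x by exact: mulr_gt0.
  have ax0 : 0 <= al * x by rewrite mulr_ge0// ltW.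
  have l00 : 0 < l0 by exact: lt_le_trans ltr01 hl0.
  have bound l := ratio_event_bound hstd hl0 hsub b0 al0 m0 hor (x := x) (l := l).
  (* The form [b + a / m] of the conjugate lemmas, with [beta * x] for [b] and [alpha * x] for
     [a]. *)
  have uE : m != 0 -> u = b * x + al * x / m by move=> m_neq0; rewrite /u; field.
  split => [hm|m_gt0 hm]; split.
  (* The supremum [slope_inv] is only approached: each [c] below the target exponent is reached by
     an admissible [l]. *)
  + apply: (outer_prob_le_exp hl0) => c hc.
    have [l [hl lb] cl] : exists2 l, psi_idom lmax l /\ psi l <= b * x * l &
        c <= al * x * l.
      (* If [al * x = 0] then [c < 0], and any admissible [l] will do. *)
      have [a_eq0|a_neq0] := eqVneq (al * x) 0.
        have D0 : slope_inv lmax psi (b * x) - 1 < slope_inv lmax psi (b * x) by lra.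
        have [l hl _] := slope_inv_gt lmax0 hpsi bx0 D0.
        by exists l => //; move: hc; rewrite a_eq0 !mul0r => /ltW.
      have a_gt0 : 0 < al * x by rewrite lt_neqAle eq_sym a_neq0.
      have : c / (al * x) < slope_inv lmax psi (b * x) by rewrite ltr_pdivrMr// mulrC.
      move=> /(slope_inv_gt lmax0 hpsi bx0)[l hl cl]; exists l => //.
      by move: cl; rewrite ltr_pdivrMr// mulrC => /ltW.
    have dl : psi_dom lmax l by case: hl => /ltW.
    rewrite mulrC in lb; apply: le_trans (bound l dl lb) _.
    rewrite lee_fin ler_pM2l// ler_expR lerN2; apply: le_trans cl _.
    by have := ler_wpM2l m0 lb; lra.
  + rewrite /rhs1 /rhs3 ler_pM2l// ler_expR -opprD lerN2.
    apply: (psi_star_slope_inv_le lmax0) => //.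
    case: hm => [->|]; first by left.
    (* At [m = 0] division by zero makes [u] equal to 0, not [b * x], so this case is sent to the
       other disjunct. *)
    have [->|m_neq0] := eqVneq m 0; first by left.
    by rewrite uE//; right.
  + have u0 : 0 < u.
      by rewrite /u divr_gt0// mulr_gt0// ltr_wpDl// mulr_gt0.
    (* [l] is the unconstrained maximizer, attaining [psi_star] at [u]; the case hypothesis makes it
       admissible. *)
    have [l hl lu] := psi_derive_surj lmax0 hpsi hbar u0.
    have [l_gt0 ll] := hl.
    have dl : psi_dom lmax l by split => //; exact: ltW.
    have lb : psi l <= l * (b * x).
      move: hm; rewrite /slope_tr -lu derive1_psi_star ?lu//.
      by rewrite ler_pdivrMr// (mulrC _ l).
    apply: le_trans (bound l dl lb) _.
    rewrite lee_fin /rhs2 -lu psi_star_derive// lu ler_pM2l// ler_expR lerN2.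
    suff -> : l * x * (al + b * m) - m * psi l = m * (l * u - psi l) by [].
    by rewrite /u; field; exact: lt0r_neq0.
  + rewrite /rhs2 /rhs3 ler_pM2l// ler_expR -opprD lerN2 uE ?lt0r_neq0//.
    exact: psi_star_line_le.
- move=> hsub al b m x b0 x0 al0 m0 hor.
  have l00 : 0 < l0 by exact: lt_le_trans ltr01 hl0.
  have bx0 : 0 < b * x by exact: mulr_gt0.
  (* For [psi l = l ^+ 2 / 2] the admissibility condition is [l <= 2 * b * x]. *)
  have bound l : 0 <= l -> l / 2 <= b * x -> (outer_prob P (ratio_event k S V al b m x) <=
      (l0 * expR (- (l * x * (al + b * m) - m * (l ^+ 2 / 2))))%:E)%E.
    move=> l_ge0 lb; apply: (ratio_event_bound hstd hl0 hsub) => //.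
      by split => //; rewrite ltry.
    by rewrite expr2 -mulrA ler_wpM2l.
  have [abm|abm] := leP al (b * m).
    have m_gt0 : 0 < m.
      by case: hor => // al_gt0; have := lt_le_trans al_gt0 abm; rewrite pmulr_rgt0.
    have mm : m != 0 by exact: lt0r_neq0.
    (* The vertex of the quadratic exponent, admissible exactly when [al <= b * m]. *)
    have := bound (x * (al + b * m) / m).
    rewrite (_ : - (x * (al + b * m) / m * x * (al + b * m) -
        m * ((x * (al + b * m) / m) ^+ 2 / 2)) =
      - (x ^+ 2 * (2 * al * b + (b * m - al) ^+ 2 * true%:R / (2 * m)))); last by rewrite mulr1; field.
    apply.
      by rewrite divr_ge0// mulr_ge0 ?addr_ge0// ?mulr_ge0// ltW.
    rewrite !ler_pdivrMr ?ltr0n//.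
    by have := ler_wpM2l (ltW x0) abm; lra.
  (* Otherwise, which includes [m = 0], take the largest admissible [l]; the indicator vanishes. *)
  have := bound (2 * (b * x)).
  rewrite mulr0 mul0r addr0.
  rewrite (_ : - (2 * (b * x) * x * (al + b * m) - m * ((2 * (b * x)) ^+ 2 / 2)) =
    - (x ^+ 2 * (2 * al * b))); last by field.
  by apply; lra.
Qed.
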